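(* Let $D$ be a connected digraph (without loops and multiple arcs) with $N$ vertices and $M$ arcs, with positive reals $\beta_e$ ($e\in A(D)$) and $\delta_x$ ($x\in V(D)$). Write \[ A(D)=\{e_1,\dots,e_{M_0},f_1,\dots,f_{M_1},f_1^{-1},\dots,f_{M_1}^{-1}\}, \] where $e_i^{-1}\notin A(D)$ for $1\le i\le M_0$. Then, as an identity of rational functions in $u$ (equivalently, for every complex $u$ at which all denominators below are nonzero), \[ \det(I_{N+M}-u\mathcal{A}) = \prod_{j=1}^{M_0}(1+\gamma_{e_j}u)\prod_{k=1}^{M_1}G_k\;\det\!\big(I_N+u\mathbf{D}-uA_{nsym}^T-uA_{sym}+u^2\tilde D\big), \] where $\gamma_e=\beta_e+\delta_{o(e)}+\delta_{t(e)}$ for $e\in A(D)$ and \[ G_k=1+(\gamma_{f_k}+\gamma_{f_k^{-1}})u+u^2(\gamma_{f_k}\gamma_{f_k^{-1}}-\beta_{f_k}\beta_{f_k^{-1}})\quad(1\le k\le M_1). \]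
   Context: For an arc $e=(x,y)$ write $o(e)=x$, $t(e)=y$, $e^{-1}=(y,x)$. Put $\epsilon_e=\delta_{o(e)}+\delta_{t(e)}$, and for an arc $e$ with $e^{-1}\in A(D)$ put $G_e=1+(\gamma_e+\gamma_{e^{-1}})u+u^2(\gamma_e\gamma_{e^{-1}}-\beta_e\beta_{e^{-1}})$ (so $G_{f_k}=G_{f_k^{-1}}=G_k$). $\mathbf{D}=\mathrm{diag}(\delta_x)_{x\in V(D)}$. The $N\times N$ matrices (depending on $u$) are: $(A_{nsym})_{xy}=\beta_{(x,y)}(1+\epsilon_{(x,y)}u)/(1+\gamma_{(x,y)}u)$ if $(x,y)\in A(D)$ and $(y,x)\notin A(D)$, and $0$ otherwise; $(A_{sym})_{xy}=\beta_{(y,x)}(1+\gamma_{(x,y)}u)(1+\epsilon_{(x,y)}u)/G_{(x,y)}$ if $(x,y),(y,x)\in A(D)$, and $0$ otherwise; $\tilde D$ is diagonal with $\tilde D_{xx}=\sum_{e:\,o(e)=x,\ e^{-1}\in A(D)}\beta_e\beta_{e^{-1}}(1+\epsilon_e u)/G_e$. The Metzler matrix $\mathcal{A}$ is the $(N+M)\times(N+M)$ matrix with rows and columns indexed by $V(D)\cup A(D)$ and blocks: $\mathcal{A}_{xy}=-\delta_x$ if $x=y$ and $0$ otherwise ($x,y\in V(D)$); $\mathcal{A}_{x e}=\beta_e$ if $t(e)=x$ and $0$ otherwise; $\mathcal{A}_{e x}=\delta_{t(e)}$ if $o(e)=x$ and $0$ otherwise; and for arcs $e,f$: $\mathcal{A}_{ef}=\beta_f\,[\,t(f)=o(e),\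 e\neq f^{-1}\,]-\gamma_e[e=f]$. Equivalently $\mathcal{A}=\begin{bmatrix}-\mathbf{D}&KB'\\ D_2'L^T& H^TB'-B'-D_1'-D_2'\end{bmatrix}$ with $K,L$ the terminus/origin incidence matrices ($K_{xe}=[t(e)=x]$, $L_{xe}=[o(e)=x]$), $H$ the non-backtracking matrix ($H_{ef}=1$ iff $t(e)=o(f)$, $f\ne e^{-1}$), and $B'=\mathrm{diag}(\beta_e)$, $D_1'=\mathrm{diag}(\delta_{o(e)})$, $D_2'=\mathrm{diag}(\delta_{t(e)})$. *)

(* Defs.v *)
From HB Require Import structures.
From mathcomp Require Import all_boot all_order all_algebra.

Set Implicit Arguments.
Unset Strict Implicit.
Unset Printing Implicit Defensive.

Import Order.TTheory GRing.Theory Num.Theory.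
Local Open Scope ring_scope.

(* A digraph without multiple arcs on V is its arc set A : {set V * V}, the
   arc (x, y) going from x to y. *)
Section Digraph.

Variable V : finType.

Definition arc_rev (e : V * V) : V * V := (e.2, e.1).

Definition loopless (A : {set V * V}) : Prop := forall x : V, (x, x) \notin A.

(* Connectedness of the underlying undirected graph. *)
Definition weakly_connected (A : {set V * V}) : Prop :=
  forall x y : V,
    connect [rel a b | ((a, b) \in A) || ((b, a) \in A)] x y.

(* A = {e_1, .., e_M0, f_1, .., f_M1, f_1^-1, .., f_M1^-1}, listed without
   repetition, no e_j being the reverse of an arc. *)
Definition arc_listing (A : {set V * V}) (M0 M1 : nat)
    (e : 'I_M0 -> V * V) (f : 'I_M1 -> V * V) : Prop :=
  let s := codom e ++ codom f ++ codom (arc_rev \o f) in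
  [/\ uniq s, s =i A & forall j, arc_rev (e j) \notin A].

End Digraph.

(* Rows and columns are indexed through enum_val : 'I_#|V| -> V and
   enum_val : 'I_#|A| -> V * V, the enumerations of V and of A.  The functions
   beta and delta are total, but beta is only used on arcs. *)
Section Matrices.

Variables (F : fieldType) (V : finType) (A : {set V * V}).
Variables (beta : V * V -> F) (delta : V -> F) (u : F).

Definition gamma (e : V * V) : F := beta e + delta e.1 + delta e.2.

Definition epsilon (e : V * V) : F := delta e.1 + delta e.2.

Definition G (e : V * V) : F :=
  1 + (gamma e + gamma (arc_rev e)) * u
    + u ^+ 2 * (gamma e * gamma (arc_rev e) - beta e * beta (arc_rev e)).

Definition deltamx : 'M[F]_#|V| := diag_mx (\row_i delta (enum_val i)).

Definition A_nsym : 'M[F]_#|V| :=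
  \matrix_(i, j) let x := enum_val i in let y := enum_val j in
    if ((x, y) \in A) && ((y, x) \notin A) then
      beta (x, y) * (1 + epsilon (x, y) * u) / (1 + gamma (x, y) * u)
    else 0.

Definition A_sym : 'M[F]_#|V| :=
  \matrix_(i, j) let x := enum_val i in let y := enum_val j in
    if ((x, y) \in A) && ((y, x) \in A) then
      beta (y, x) * (1 + gamma (x, y) * u) * (1 + epsilon (x, y) * u)
        / G (x, y)
    else 0.

Definition D_tilde : 'M[F]_#|V| :=
  diag_mx (\row_i
    \sum_(e in A | (e.1 == enum_val i) && (arc_rev e \in A))
      beta e * beta (arc_rev e) * (1 + epsilon e * u) / G e).

Definition metzler : 'M[F]_(#|V| + #|A|) :=
  block_mx
    (\matrix_(i < #|V|, j < #|V|)
       let x := enum_val i in let y := enum_val j in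
       if x == y then - delta x else 0)
    (\matrix_(i < #|V|, j < #|A|)
       let x := enum_val i in let e := enum_val j in
       if e.2 == x then beta e else 0)
    (\matrix_(i < #|A|, j < #|V|)
       let e := enum_val i in let x := enum_val j in
       if e.1 == x then delta e.2 else 0)
    (\matrix_(i < #|A|, j < #|A|)
       let e := enum_val i in let f := enum_val j in
       (if (f.2 == e.1) && (e != arc_rev f) then beta f else 0)
       - (if e == f then gamma e else 0)).

Definition metzler_det_identity (M0 M1 : nat)
    (e : 'I_M0 -> V * V) (f : 'I_M1 -> V * V) : Prop :=
  \det (1%:M - u *: metzler) =
    (\prod_(j < M0) (1 + gamma (e j) * u)) * (\prod_(k < M1) G (f k))
    * \det (1%:M + u *: deltamx - u *: A_nsym^T - u *: A_sym
            + u ^+ 2 *: D_tilde).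

Definition nonzero_denominators : Prop :=
  forall e : V * V, e \in A ->
    if arc_rev e \in A then G e != 0 else 1 + gamma e * u != 0.

End Matrices.

(* Main.v *)
Require Import Defs.
From HB Require Import structures.
From mathcomp Require Import all_boot all_order all_fingroup all_algebra.
From mathcomp Require Import reals complex ring.

Set Implicit Arguments.
Unset Strict Implicit.
Unset Printing Implicit Defensive.

Import Order.TTheory GRing.Theory Num.Theory.
Local Open Scope ring_scope.
Local Open Scope complex_scope.

(* Let Q_ax = [o(a) = x] and P_xa = beta_a [t(a) = x].  The arc block of
   I - u*A is W - u*Q*P, where W only couples an arc with itself and with its
   reverse, so subtracting Q times the vertex rows from the arc rows turns
   I - u*A into [[I + u*D, -u*P], [-E, W]] with E_ax = (1 + epsilon_a u) Q_ax.
   If W*Z = E, adding to the vertex columns the arc columns times Z makes this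
   block triangular, and the determinant is det W * det(I + u*D - u*P*Z).
   The listing of the arcs splits W into blocks of size 1 and 2 whose
   determinants are the 1 + gamma_e u and the G_k, and Z is explicit. *)

(** * Determinants of block matrices and reindexing *)

(* Replacing D by X + D over the polynomials makes its determinant monic, hence
   cancellable; the formula is then evaluated at X = 0. *)
Lemma det_block_comm (F : fieldType) (n : nat) (A B C D : 'M[F]_n) :
  C *m D = D *m C -> \det (block_mx A B C D) = \det (A *m D - B *m C).
Proof.
move=> CD.
(* [char_poly_mx (- D)] is D plus the indeterminate times the identity. *)
pose X := block_mx (map_mx polyC A) (map_mx polyC B) (map_mx polyC C)
                   (char_poly_mx (- D)).
pose Y := map_mx polyC A *m char_poly_mx (- D)
          - map_mx polyC B *m map_mx polyC C.
have ev0 m (N : 'M[F]_m) : map_mx (horner_eval 0) (map_mx polyC N) = N.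
  by apply/matrixP=> i j; rewrite !mxE /= horner_evalE hornerC.
have evD : map_mx (horner_eval 0) (char_poly_mx (- D)) = D.
  apply/matrixP=> i j.
  by rewrite !mxE /= !horner_evalE !hornerE hornerMn hornerX mul0rn sub0r opprK.
have evX : map_mx (horner_eval 0) X = block_mx A B C D.
  by rewrite map_block_mx !ev0 evD.
have evY : map_mx (horner_eval 0) Y = A *m D - B *m C.
  by rewrite map_mxB !map_mxM !ev0 evD.
rewrite -evX -evY !det_map_mx; congr horner_eval.
have CD' : map_mx polyC C *m char_poly_mx (- D)
           = char_poly_mx (- D) *m map_mx polyC C.
  rewrite /char_poly_mx mulmxBr mulmxBl -!map_mxM /= mulmxN mulNmx CD.
  by rewrite scalar_mxC.
(* The right factor clears the lower left block because C and D commute. *)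
have XT : X *m block_mx (char_poly_mx (- D)) 0 (- map_mx polyC C) 1%:M
          = block_mx Y (map_mx polyC B) 0 (char_poly_mx (- D)).
  by rewrite mulmx_block !mulmx0 !mulmx1 !mulmxN CD' subrr !add0r.
have D0 : \det (char_poly_mx (- D)) != 0.
  by rewrite -/(char_poly _) monic_neq0 // char_poly_monic.
apply: (mulIf D0).
by rewrite -(det_ublock Y (map_mx polyC B)) -XT det_mulmx det_lblock det1 mulr1.
Qed.

(** Diagonal blocks commute. Each factor is the 2 by 2 determinant that an arc f_k and its reverse
    will contribute. *)
Lemma det_block_diag (F : fieldType) (n : nat) (a b c d : 'rV[F]_n) :
  \det (block_mx (diag_mx a) (diag_mx b) (diag_mx c) (diag_mx d))
  = \prod_i (a 0 i * d 0 i - b 0 i * c 0 i).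
Proof.
rewrite det_block_comm; last exact: diag_mx_comm.
rewrite !mulmx_diag -raddfB det_diag; apply: eq_bigr => i _.
by rewrite !mxE.
Qed.

(** An injection between ordinals of equal size is a permutation, and its sign enters twice, through
    the rows and through the columns. Keeping [m = n] as a hypothesis allows sizes that are only
    provably equal. *)
Lemma det_reindex_inj (R : comNzRingType) (m n : nat) (h : 'I_m -> 'I_n)
    (w : 'I_n -> 'I_n -> R) :
  m = n -> injective h ->
  \det (\matrix_(i, j) w i j) = \det (\matrix_(i, j) w (h i) (h j)).
Proof.
move=> mn; case: n / mn h w => h w h_inj.
have -> : \matrix_(i, j) w (h i) (h j)
          = row_perm (perm h_inj) (col_perm (perm h_inj) (\matrix_(i, j) w i j)).
  by apply/matrixP=> i j; rewrite !mxE !permE.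
rewrite row_permE col_permE !det_mulmx !det_perm odd_permV mulrCA.
by rewrite -signr_addb addbb mulr1.
Qed.

(** This frees the determinant from the arbitrary order of [enum_val]: both families list A, so they
    differ by a permutation. *)
Lemma det_enum_val (R : comNzRingType) (T : finType) (A : {set T}) (m : nat)
    (g : 'I_m -> T) (w : T -> T -> R) :
  #|A| = m -> (forall i, g i \in A) -> injective g ->
  \det (\matrix_(i < #|A|, j < #|A|) w (enum_val i) (enum_val j))
  = \det (\matrix_(i, j) w (g i) (g j)).
Proof.
move=> Am gA g_inj.
pose h i := enum_rank_in (gA i) (g i).
have hK i : enum_val (h i) = g i by rewrite enum_rankK_in.
have h_inj : injective h.
  by move=> i j ij; apply: g_inj; rewrite -!hK ij.
rewrite (det_reindex_inj (fun i j => w (enum_val i) (enum_val j))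
  (esym Am) h_inj).
by congr (\det _); apply/matrixP=> i j; rewrite !mxE !hK.
Qed.

Lemma arc_revK (V : finType) : involutive (@arc_rev V).
Proof. by case. Qed.

(** * The listing of the arcs *)

Section Identity.

Variables (F : fieldType) (V : finType) (A : {set V * V}).
Variables (beta : V * V -> F) (delta : V -> F) (u : F).
Variables (M0 M1 : nat) (e : 'I_M0 -> V * V) (f : 'I_M1 -> V * V).
Hypothesis A_listing : arc_listing A e f.

Local Notation gamma := (gamma beta delta).
Local Notation epsilon := (epsilon delta).
Local Notation G := (G beta delta u).

(** Placing all f_k before all their reverses turns their part of W into a square of four diagonal
    blocks. *)
Definition listed_arc (i : 'I_(M0 + (M1 + M1))) : V * V :=
  match split i with
  | inl j => e j
  | inr k => match split k with inl l => f l | inr l => arc_rev (f l) end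
  end.

Lemma listed_arc_e j : listed_arc (lshift _ j) = e j.
Proof. by rewrite /listed_arc (unsplitK (inl j)). Qed.

Lemma listed_arc_f k : listed_arc (rshift _ (lshift _ k)) = f k.
Proof.
by rewrite /listed_arc (unsplitK (inr (lshift _ k))) (unsplitK (inl k)).
Qed.

Lemma listed_arc_rev_f k : listed_arc (rshift _ (rshift _ k)) = arc_rev (f k).
Proof.
by rewrite /listed_arc (unsplitK (inr (rshift _ k))) (unsplitK (inr k)).
Qed.

Definition listed_arcE := (listed_arc_e, listed_arc_f, listed_arc_rev_f).

Lemma listing_inj :
  [/\ injective e, injective f, forall j k, e j != f k,
      forall j k, e j != arc_rev (f k) & forall k l, f k != arc_rev (f l)].
Proof.
have [us _ _] := A_listing; move: us.
rewrite !cat_uniq has_cat negb_or => /and3P[ue /andP[/hasPn ef /hasPn er]].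
move=> /and3P[uf /hasPn fr _].
split; [exact/injectiveP | exact/injectiveP | | | ] => i k; apply/eqP=> E.
- by have /negP[] := ef _ (codom_f f k); rewrite -E codom_f.
- by have /negP[] := er _ (codom_f (@arc_rev V \o f) k); rewrite /= -E codom_f.
- by have /negP[] := fr _ (codom_f (@arc_rev V \o f) k); rewrite /= -E codom_f.
Qed.

Lemma listed_arc_in i : listed_arc i \in A.
Proof.
have [_ sA _] := A_listing.
rewrite -sA !mem_cat /listed_arc; case: (split i) => [j|k].
  by rewrite codom_f.
case: (split k) => l; first by rewrite codom_f orbT.
by rewrite (codom_f (@arc_rev V \o f) l) !orbT.
Qed.

Lemma listed_arc_inj : injective listed_arc.
Proof.
have [ei fi /(_ _ _)/negPf ef /(_ _ _)/negPf er /(_ _ _)/negPf fr] :=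
  listing_inj.
move=> i j /eqP; rewrite -(splitK i) -(splitK j).
case: (split i) => [i1|i1]; case: (split j) => [j1|j1] /=; last first.
- rewrite -(splitK i1) -(splitK j1).
  case: (split i1) => k; case: (split j1) => l /=; rewrite !listed_arcE.
  + by rewrite (inj_eq fi) => /eqP->.
  + by rewrite fr.
  + by rewrite eq_sym fr.
  + by rewrite (inj_eq (can_inj (@arc_revK V))) (inj_eq fi) => /eqP->.
- rewrite -(splitK i1).
  by case: (split i1) => k /=; rewrite !listed_arcE eq_sym ?ef ?er.
- rewrite -(splitK j1).
  by case: (split j1) => k /=; rewrite !listed_arcE ?ef ?er.
- by rewrite !listed_arcE (inj_eq ei) => /eqP->.
Qed.

Lemma card_arcs : #|A| = (M0 + (M1 + M1))%N.
Proof.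
have [us sA _] := A_listing.
by rewrite -(eq_card sA) (card_uniqP us) !size_cat !size_codom !card_ord.
Qed.

(** * The determinant of W *)

(* The entries of the matrix W of the header. *)
Definition pair_weight (a b : V * V) : F :=
  (1 + gamma a * u) *+ (a == b) + (u * beta b) *+ (a == arc_rev b).

Definition pair_mx : 'M[F]_#|A| :=
  \matrix_(i, j) pair_weight (enum_val i) (enum_val j).

(** In the listed order W is block diagonal. The part of the e_j is diagonal, since no reverse of an
    e_j is an arc. A pair a = f_k, b = f_k^-1 contributes (1 + gamma_a u)(1 + gamma_b u) - u^2
    beta_a beta_b = G_k. *)
Lemma det_pair_mx :
  \det pair_mx
  = (\prod_(j < M0) (1 + gamma (e j) * u)) * \prod_(k < M1) G (f k).
Proof.
have [ei fi /(_ _ _)/negPf ef /(_ _ _)/negPf er /(_ _ _)/negPf fr] :=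
  listing_inj.
have [_ sA eA] := A_listing.
have ee i j : (e i == arc_rev (e j)) = false.
  apply/negbTE/eqP=> E; have /negP[] := eA j.
  by rewrite -E -sA mem_cat codom_f.
rewrite /pair_mx
  (det_enum_val pair_weight card_arcs listed_arc_in listed_arc_inj).
have -> : \matrix_(i, j) pair_weight (listed_arc i) (listed_arc j)
  = block_mx (diag_mx (\row_j (1 + gamma (e j) * u))) 0 0
     (block_mx (diag_mx (\row_k (1 + gamma (f k) * u)))
               (diag_mx (\row_k (u * beta (arc_rev (f k)))))
               (diag_mx (\row_k (u * beta (f k))))
               (diag_mx (\row_k (1 + gamma (arc_rev (f k)) * u)))).
  apply/matrixP=> i j; rewrite -(splitK i) -(splitK j).
  case: (split i) => [i1|i1]; case: (split j) => [j1|j1] /=.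
  - rewrite block_mxEul !mxE !listed_arcE /pair_weight ee (inj_eq ei) addr0.
    by case: eqP => [->|].
  - rewrite -(splitK j1); case: (split j1) => k /=;
    by rewrite block_mxEur !mxE !listed_arcE /pair_weight ?arc_revK ?ef ?er addr0.
  - rewrite -(splitK i1); case: (split i1) => k /=;
    rewrite block_mxEdl !mxE !listed_arcE /pair_weight.
    + rewrite eq_sym ef -(inj_eq (can_inj (@arc_revK V))) arc_revK eq_sym er.
      by rewrite addr0.
    + rewrite eq_sym er (inj_eq (can_inj (@arc_revK V))) eq_sym ef.
      by rewrite addr0.
  rewrite block_mxEdr -(splitK i1) -(splitK j1).
  case: (split i1) => k; case: (split j1) => l /=.
  - rewrite block_mxEul !mxE !listed_arcE /pair_weight (inj_eq fi) fr addr0.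
    by case: eqP => [->|].
  - rewrite block_mxEur !mxE !listed_arcE /pair_weight fr arc_revK (inj_eq fi).
    by rewrite add0r; case: eqP => [->|].
  - rewrite block_mxEdl !mxE !listed_arcE /pair_weight eq_sym fr add0r.
    by rewrite (inj_eq (can_inj (@arc_revK V))) (inj_eq fi); case: eqP => [->|].
  - rewrite block_mxEdr !mxE !listed_arcE /pair_weight arc_revK.
    rewrite (inj_eq (can_inj (@arc_revK V))) (inj_eq fi) (eq_sym _ (f l)) fr.
    by rewrite addr0; case: eqP => [->|].
rewrite det_ublock det_diag det_block_diag; congr (_ * _).
  by apply: eq_bigr => j _; rewrite mxE.
by apply: eq_bigr => k _; rewrite !mxE /Defs.G; ring.
Qed.

(** * Solving W Z = E *)

(* The entries of the matrix Z of the header. *)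
Definition solution_weight (a : V * V) (x : V) : F :=
  if arc_rev a \in A then
    (1 + epsilon a * u) / G a *
    ((1 + gamma (arc_rev a) * u) *+ (a.1 == x)
     - (u * beta (arc_rev a)) *+ (a.2 == x))
  else (1 + epsilon a * u) / (1 + gamma a * u) *+ (a.1 == x).

Definition solution_mx : 'M[F]_(#|A|, #|V|) :=
  \matrix_(i, j) solution_weight (enum_val i) (enum_val j).

Hypothesis nz : nonzero_denominators A beta delta u.

Lemma G_rev a : G (arc_rev a) = G a.
Proof. by rewrite /Defs.G arc_revK; ring. Qed.

Lemma epsilon_rev a : epsilon (arc_rev a) = epsilon a.
Proof. exact: addrC. Qed.

Lemma sum_arc_pick (w : V * V -> F) (a : V * V) :
  \sum_(b in A) w b *+ (b == a) = w a *+ (a \in A).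
Proof.
case: (boolP (a \in A)) => aA.
  rewrite (bigD1 a) //= eqxx big1 ?addr0 // => b /andP[_ /negPf->].
  by rewrite mulr0n.
rewrite big1 // => b bA; case: eqP bA => // ->.
by rewrite (negPf aA).
Qed.

(** The row of a involves Z only at a and at its reverse. If both are arcs, Z comes from Cramer's
    rule for a 2 by 2 system of determinant G_a; otherwise it comes from division by 1 + gamma_a
    u. *)
Lemma pair_mx_solution :
  pair_mx *m solution_mx
  = \matrix_(i, j)
      ((1 + epsilon (enum_val i) * u) *+ ((enum_val i).1 == enum_val j)).
Proof.
apply/matrixP=> i j; rewrite !mxE.
set a := enum_val i; set x := enum_val j.
have aA : a \in A := enum_valP i.
under eq_bigr => k _ do rewrite !mxE -/a -/x.
rewrite -(big_enum_val (fun b => pair_weight a b * solution_weight b x)) /=.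
have pwE b : pair_weight a b * solution_weight b x
  = ((1 + gamma a * u) * solution_weight b x) *+ (b == a)
    + (u * beta b * solution_weight b x) *+ (b == arc_rev a).
  rewrite /pair_weight mulrDl !mulrnAl (eq_sym a b); congr (_ + _ *+ _).
  by rewrite -(inj_eq (can_inj (@arc_revK V))) arc_revK eq_sym.
(* The term of the reverse survives only when the reverse is an arc, which matches the case split in
   [solution_weight]. *)
rewrite (eq_bigr _ (fun b _ => pwE b)) big_split /= !sum_arc_pick aA mulr1n.
have := nz aA; rewrite /solution_weight arc_revK aA G_rev epsilon_rev /=.
case: ifP => _ nza.
  rewrite mulr1n; case: (a.1 == x); case: (a.2 == x);
  rewrite ?mulr1n ?mulr0n; move: nza; rewrite /Defs.G => nza; field => //.
rewrite mulr0n addr0; case: (a.1 == x); rewrite ?mulr1n ?mulr0n ?mulr0 //.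
by field.
Qed.

(** * The vertex matrix P Z *)

(** The matrix P of the header. *)
Definition head_mx : 'M[F]_(#|V|, #|A|) :=
  \matrix_(i, j) (beta (enum_val j) *+ ((enum_val j).2 == enum_val i)).

(** At entry (x, y) only arcs b ending at x count. The part of Z at the origin of b forces b = (y,
    x), which gives [A_nsym] transposed or [A_sym] according to whether (x, y) is an arc. The part
    at the terminus forces x = y and gives [D_tilde]. *)
Lemma head_mx_solution :
  head_mx *m solution_mx
  = (A_nsym A beta delta u)^T + A_sym A beta delta u
    - u *: D_tilde A beta delta u.
Proof.
apply/matrixP=> i j; rewrite !mxE.
set x := enum_val i; set y := enum_val j.
under eq_bigr => k _ do rewrite !mxE -/x -/y.
rewrite -(big_enum_val
  (fun b => beta b *+ (b.2 == x) * solution_weight b y)) /=.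
pose c b := beta b * ((1 + epsilon b * u) *
  (if arc_rev b \in A then (1 + gamma (arc_rev b) * u) / G b
   else (1 + gamma b * u)^-1)).
pose d b := beta b * beta (arc_rev b) * (1 + epsilon b * u) / G b.
have swE b : beta b *+ (b.2 == x) * solution_weight b y
  = c b *+ (b == (y, x))
    - u * (d b *+ ((b.2 == x) && (arc_rev b \in A)) *+ (x == y)).
  rewrite /solution_weight /c /d; case: b => b1 b2 /=.
  rewrite xpair_eqE /=.
  case: (eqVneq b2 x) => [->|_]; last by rewrite andbF !mul0rn mulr0 subr0 mul0r.
  rewrite andbT; case: ifP => _; case: (b1 == y); case: (x == y);
    rewrite /= ?mulr1n ?mulr0n; ring.
rewrite (eq_bigr _ (fun b _ => swE b)) sumrB sum_arc_pick; congr (_ - _).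
  rewrite /c /arc_rev /=; case: ((y, x) \in A); case: ((x, y) \in A) => /=;
    rewrite ?mulr1n ?mulr0n ?add0r ?addr0 //.
  - rewrite -[(y, x)]/(arc_rev (x, y)) G_rev epsilon_rev; ring.
  - by rewrite mulrA.
rewrite -mulr_sumr sumrMnl; congr (_ * _).
rewrite -(inj_eq enum_val_inj).
congr (_ *+ _).
(* The left sum runs over arcs ending at x, that of [D_tilde] over arcs starting there; reversal
   exchanges them and preserves the summand. *)
rewrite [RHS](reindex_inj (can_inj (@arc_revK V))) /=.
rewrite big_mkcond [RHS]big_mkcond /=.
apply: eq_bigr => b _; rewrite arc_revK G_rev epsilon_rev /d.
rewrite [X in _ = if _ then X * _ / _ else _]mulrC.
by case: (b \in A); case: (arc_rev b \in A); case: (b.2 == x).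
Qed.

(** * Block elimination *)

(** The field is arbitrary, so that rational functions and complex numbers are both instances. *)
Lemma metzler_det_identity_of_nonzero :
  metzler_det_identity A beta delta u e f.
Proof.
rewrite /metzler_det_identity -det_pair_mx.
set S := 1%:M + _ - _ - _ + _.
pose Q := \matrix_(i < #|A|, j < #|V|) (((enum_val i).1 == enum_val j)%:R : F).
pose E := \matrix_(i < #|A|, j < #|V|)
      ((1 + epsilon (enum_val i) * u) *+ ((enum_val i).1 == enum_val j)).
have Q_mul p (N : 'M[F]_(#|V|, p)) i j :
    (Q *m N) i j = N (enum_rank (enum_val i).1) j.
  rewrite mxE (bigD1 (enum_rank (enum_val i).1)) //= mxE enum_rankK eqxx mul1r.
  rewrite big1 ?addr0 // => k; rewrite mxE.
  case: (eqVneq (enum_val i).1 (enum_val k)) => [->|_ _]; last by rewrite mul0r.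
  by rewrite enum_valK eqxx.
pose reduced := block_mx (1%:M + u *: deltamx delta) (- (u *: head_mx))
                         (- E) pair_mx.
have rowop : block_mx 1%:M 0 (- Q) 1%:M *m (1%:M - u *: metzler A beta delta)
  = reduced.
  rewrite scalar_mx_block scale_block_mx opp_block_mx add_block_mx mulmx_block.
  rewrite !mul1mx !mul0mx !addr0 !sub0r !mulNmx.
  congr block_mx; apply/matrixP=> i j.
  - rewrite !mxE /= (inj_eq enum_val_inj).
    by case: (i == j); rewrite ?mulr1n ?mulr0n; ring.
  - by rewrite !mxE /=; case: eqP.
  (* The row of the origin supplies the delta that completes the delta of the terminus to
     epsilon. *)
  - rewrite 2!mxE Q_mul !mxE /= enum_rankK (can2_eq enum_rankK enum_valK).
    by case: eqP => _; rewrite /Defs.epsilon ?mulr1n ?mulr0n; ring.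
  (* Every coupling u beta_b cancels except the backtracking one, a = b^-1, which the Metzler matrix
     omits. *)
  - rewrite 2!mxE Q_mul !mxE /= enum_rankK /pair_weight.
    set a := enum_val i; set b := enum_val j.
    rewrite -[i == j](inj_eq enum_val_inj) -/a -/b.
    case: (eqVneq a (arc_rev b)) => [->|_] /=.
      by rewrite !eqxx; case: eqP => _; rewrite ?mulr1n ?mulr0n /=; ring.
    by rewrite andbT; case: eqP => _; case: eqP => [->|_];
      rewrite ?mulr1n ?mulr0n; ring.
have colop : reduced *m block_mx 1%:M 0 solution_mx 1%:M
  = block_mx S (- (u *: head_mx)) 0 pair_mx.
  rewrite mulmx_block !mulmx0 !mulmx1 !add0r pair_mx_solution addNr.
  congr block_mx; rewrite mulNmx -scalemxAl head_mx_solution /S.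
  by rewrite scalerBr scalerDr scalerA -expr2 !opprD opprK !addrA.
have := congr1 determinant colop.
rewrite -rowop !det_mulmx !det_lblock !det1 !mul1r !mulr1 => ->.
by rewrite det_ublock mulrC.
Qed.

End Identity.

(** * Rational functions and complex values *)

Theorem theorem5 (R : realType) (V : finType) (A : {set V * V})
    (A_loopless : loopless A) (A_connected : weakly_connected A)
    (beta : V * V -> R) (delta : V -> R)
    (beta_gt0 : forall e, e \in A -> 0 < beta e)
    (delta_gt0 : forall x, 0 < delta x)
    (M0 M1 : nat) (e : 'I_M0 -> V * V) (f : 'I_M1 -> V * V)
    (A_listing : arc_listing A e f) :
  (* identity of rational functions in the indeterminate u *)
  metzler_det_identity A (fun a => tofrac (beta a)%:P)
    (fun x => tofrac (delta x)%:P) (tofrac 'X : {fraction {poly R}}) e f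
  /\
  (* identity at every complex u where the denominators do not vanish *)
  (forall u : R[i],
     let betaC a := (beta a)%:C in
     let deltaC x := (delta x)%:C in
     nonzero_denominators A betaC deltaC u ->
     metzler_det_identity A betaC deltaC u e f).
Proof.
split; last by move=> u betaC deltaC; exact: metzler_det_identity_of_nonzero.
apply: metzler_det_identity_of_nonzero => // a aA.
(* Each denominator is a polynomial in u with value 1 at 0, hence nonzero in the fraction field. *)
have ev_neq0 (p : {poly R}) : p.[0] = 1 -> tofrac p != 0.
  move=> p1; rewrite tofrac_eq0; apply: contra_eq_neq p1 => ->.
  by rewrite horner0 eq_sym oner_neq0.
case: ifP => _; rewrite /G /gamma -tofrac1
  -!(tofracD, tofracM, tofracXn, tofracB).
  by apply: ev_neq0; rewrite !(hornerE, expr0n, mulr0, mul0r, addr0) /=.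
by apply: ev_neq0; rewrite !(hornerE, expr0n, mulr0, mul0r, addr0) /=.
Qed.
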